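(* Let $A$ and $B$ be unital C$^*$-algebras and let $T : S(A)\to S(B)$ be a surjective isometry. Then $T(\mathcal{U}(A)) = \mathcal{U}(B)$.
   Context: For a Banach space $X$, $S(X)$ denotes its unit sphere, i.e. the set of elements of norm $1$. A surjective isometry between unit spheres is a surjective map preserving the norm distance, $\|T(x)-T(y)\|=\|x-y\|$; no linearity of any kind is assumed. For a unital C$^*$-algebra $A$, $\mathcal{U}(A)$ denotes the group of unitaries of $A$. C$^*$-algebras are complex. *)

(* Defs.v *)
From HB Require Import structures.
From mathcomp Require Import all_boot all_order all_algebra.
From mathcomp Require Import complex.
From mathcomp Require Import all_classical all_reals all_analysis.
Import Order.TTheory GRing.Theory Num.Theory.
Import numFieldNormedType.Exports.

Set Implicit Arguments.
Unset Strict Implicit.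
Unset Printing Implicit Defensive.

Local Open Scope classical_set_scope.
Local Open Scope ring_scope.

(* A unital C*-algebra over the complex numbers [R[i]].  Hierarchy-Builder has
   no join of rings with normed modules (such a join would have to be declared
   before [numDomainType]), so the multiplication and the involution are
   bundled here on top of a Banach space; the canonical ring and algebra
   structures are recovered below.  As usual the zero algebra is excluded.
   The norm takes its values in the nonnegative reals of [R[i]]. *)
Record cstarAlgType (R : realType) := CStarAlg {
  cstar_banach : completeNormedModType R[i];
  cstar_one : cstar_banach;
  cstar_mul : cstar_banach -> cstar_banach -> cstar_banach;
  cstar_star : cstar_banach -> cstar_banach;
  cstar_mulA : associative cstar_mul;
  cstar_mul1x : left_id cstar_one cstar_mul;
  cstar_mulx1 : right_id cstar_one cstar_mul;
  cstar_mulDl : left_distributive cstar_mul +%R;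
  cstar_mulDr : right_distributive cstar_mul +%R;
  cstar_oner_neq0 : cstar_one != 0;
  cstar_scaleAl : forall (a : R[i]) x y,
    a *: cstar_mul x y = cstar_mul (a *: x) y;
  cstar_scaleAr : forall (a : R[i]) x y,
    a *: cstar_mul x y = cstar_mul x (a *: y);
  cstar_ler_normM : forall x y, `|cstar_mul x y| <= `|x| * `|y|;
  cstar_starK : involutive cstar_star;
  cstar_starD : {morph cstar_star : x y / x + y};
  cstar_starZ : forall (a : R[i]) x,
    cstar_star (a *: x) = conjc a *: cstar_star x;
  cstar_starM : forall x y,
    cstar_star (cstar_mul x y) = cstar_mul (cstar_star y) (cstar_star x);
  cstar_norm_starM : forall x, `|cstar_mul (cstar_star x) x| = `|x| ^+ 2
}.

Definition cstar_sort (R : realType) (A : cstarAlgType R) : Type :=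
  cstar_banach A.

Coercion cstar_sort : cstarAlgType >-> Sortclass.

HB.instance Definition _ (R : realType) (A : cstarAlgType R) :=
  CompleteNormedModule.copy (cstar_sort A) (cstar_banach A).

HB.instance Definition _ (R : realType) (A : cstarAlgType R) :=
  GRing.Zmodule_isNzRing.Build (cstar_sort A) (@cstar_mulA R A)
    (@cstar_mul1x R A) (@cstar_mulx1 R A) (@cstar_mulDl R A) (@cstar_mulDr R A)
    (cstar_oner_neq0 A).

HB.instance Definition _ (R : realType) (A : cstarAlgType R) :=
  GRing.Lmodule_isLalgebra.Build R[i] (cstar_sort A) (@cstar_scaleAl R A).

HB.instance Definition _ (R : realType) (A : cstarAlgType R) :=
  GRing.Lalgebra_isAlgebra.Build R[i] (cstar_sort A) (@cstar_scaleAr R A).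

Definition star (R : realType) (A : cstarAlgType R) (x : A) : A :=
  cstar_star x.

Section CStarTheory.
Variables (R : realType) (A : cstarAlgType R).
Implicit Types (a : R[i]) (x y : A).

Lemma ler_cstar_normM x y : `|x * y| <= `|x| * `|y|.
Proof. exact: cstar_ler_normM. Qed.

Lemma starK : involutive (@star R A).
Proof. exact: cstar_starK. Qed.

Lemma starD : {morph @star R A : x y / x + y}.
Proof. exact: cstar_starD. Qed.

Lemma starZ a x : star (a *: x) = conjc a *: star x.
Proof. exact: cstar_starZ. Qed.

Lemma starM x y : star (x * y) = star y * star x.
Proof. exact: cstar_starM. Qed.

Lemma norm_starM x : `|star x * x| = `|x| ^+ 2.
Proof. exact: cstar_norm_starM. Qed.

Lemma star1 : star (1 : A) = 1.
Proof. by rewrite -[LHS]mulr1 -{2}[1]starK -starM mulr1 starK. Qed.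

Lemma cstar_norm1 : `|1 : A| = 1.
Proof.
have n0 : `|1 : A| != 0 by rewrite normr_eq0 oner_neq0.
by apply: (mulfI n0); rewrite -expr2 -norm_starM star1 !mulr1.
Qed.

End CStarTheory.

Definition unit_sphere (K : numFieldType) (V : normedModType K) : set V :=
  [set x | `|x| = 1].
Arguments unit_sphere {K} V.

Definition unitaries (R : realType) (A : cstarAlgType R) : set A :=
  [set u | star u * u = 1 /\ u * star u = 1].
Arguments unitaries {R} A.

Lemma unitaries_sub_sphere (R : realType) (A : cstarAlgType R) :
  unitaries A `<=` unit_sphere A.
Proof.
move=> u [uu _]; apply/eqP.
by rewrite -(pexpr_eq1 (n := 2)) // -norm_starM uu cstar_norm1.
Qed.

(* Main.v *)
Require Import Defs.
From mathcomp Require Import all_boot all_order all_algebra complex.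
From mathcomp Require Import all_classical all_reals all_analysis.
From mathcomp Require Import ring lra.
From Stdlib Require Ncring Ncring_tac.

Import Order.TTheory GRing.Theory Num.Theory.
Import numFieldNormedType.Exports.

Set Implicit Arguments.
Unset Strict Implicit.
Unset Printing Implicit Defensive.

Local Open Scope classical_set_scope.
Local Open Scope ring_scope.

(** Unitaries are singled out by metric conditions on the sphere that spherical
    isometries preserve.

    Call [x] and [y] in a unit sphere aligned if [|x + y| = 2].  A surjective
    isometry [T] preserves [|x - y| = 2]; put [T' x = - T (- x)], so that [x]
    and [y] are aligned iff [T x] and [T' y] are.  If [x] is the midpoint of
    aligned [y] and [z], then [T x] and [T' x] are aligned, and whatever is
    aligned with [T' x] (resp. [T x]) is aligned with [T' y] and [T' z]
    (resp. [T y] and [T z]); hence [T y] and [T z] lie in any maximal clique of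
    aligned points through [T x] and [T' x], and so [T] preserves alignment.
    Call [u] exposed if it is the only point aligned with everything that is
    aligned with [u]; then [T u] is exposed too, and [T (- u) = - T u].

    In a C*-algebra, unitaries are exposed, and an exposed [x] satisfies
    [(1 - x x^* ) b (1 - x^* x) = 0] for all [b].  For exposed [v] consider the
    exposed [x] with [|v + x|, |v - x| <= sqrt 2].  If [v] is unitary then
    [i v] is an isolated such point: an exposed [w] close to [i] is unitary,
    [|1 + w|, |1 - w| <= sqrt 2] makes it skew-adjoint, and then [w = i].
    Conversely, if [v v^* <> 1], then every such [x] can be moved continuously
    by left multiplication with unitaries close to 1. *)

(** * Spherical isometries and alignment *)

Section Alignment.
Variables (K : numFieldType) (V : normedModType K).
Implicit Types x y z a : V.

Definition aligned x y := `|x + y| = 2.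

Lemma aligned_sym x y : aligned x y -> aligned y x.
Proof. by rewrite /aligned addrC. Qed.

Lemma alignedxx x : unit_sphere V x -> aligned x x.
Proof. by rewrite /aligned /unit_sphere /= -mulr2n normrMn => ->. Qed.

Lemma norm_add_max (x y : V) (r s : K) :
  `|x| <= r -> `|y| <= s -> r + s <= `|x + y| -> `|x| = r.
Proof.
move=> xr ys h; apply/eqP; move: xr; rewrite le_eqVlt => /orP[//|xr].
by have := lt_le_trans (le_lt_trans (ler_normD x y) (ltr_leD xr ys)) h; rewrite ltxx.
Qed.

(** [z + x] and [z + y] have norm at most 2, and their sum is twice a vector of norm 2; so both
    bounds are attained. *)
Lemma aligned_mid x y z : unit_sphere V x -> unit_sphere V y -> unit_sphere V z ->
  aligned z (2^-1 *: (x + y)) -> aligned z x.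
Proof.
rewrite /unit_sphere /aligned /= => nx ny nz h.
have le2 (a : V) : `|a| = 1 -> `|z + a| <= 2.
  by move=> na; rewrite (le_trans (ler_normD _ _))// nz na.
apply: (norm_add_max (le2 _ nx) (le2 _ ny)).
suff -> : z + x + (z + y) = 2 *: (z + 2^-1 *: (x + y)).
  by rewrite normrZ h normr_nat -mulr2n mulr_natl.
rewrite scalerDr scalerA mulfV ?pnatr_eq0// scale1r scaler_nat mulr2n.
by rewrite addrACA.
Qed.

Lemma mid_sphere x y : aligned x y -> unit_sphere V (2^-1 *: (x + y)).
Proof.
by rewrite /aligned /unit_sphere /= normrZ normfV normr_nat => ->; rewrite mulVf ?pnatr_eq0.
Qed.

Definition exposed u := unit_sphere V u /\
  forall z, unit_sphere V z ->
    (forall y, unit_sphere V y -> aligned y u -> aligned z y) -> z = u.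

(** If [y] is aligned with [x], then [y + (x + a)] and [y + (x - a)] have norm at most 2 and sum to
    [2 (y + x)], of norm 4; so [y] is aligned with [x + a], and exposedness forces [x + a = x]. *)
Lemma exposed_extreme x a :
  exposed x -> `|x + a| <= 1 -> `|x - a| <= 1 -> a = 0.
Proof.
case=> nx ex h1 h2.
have h1' : `|x + a| = 1.
  apply: (norm_add_max h1 h2).
  by rewrite [x + a + _]addrACA subrr addr0 -mulr2n normrMn nx.
suff /addrI : x + a = x + 0 by [].
rewrite addr0; apply: ex => // y ny yx; rewrite /aligned.
have b2 c : `|c| <= 1 -> `|y + c| <= 2.
  by move=> hc; rewrite (le_trans (ler_normD _ _))// ny -(natr1 1) lerD.
rewrite addrC; apply: (norm_add_max (b2 _ h1) (b2 _ h2)).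
have -> : y + (x + a) + (y + (x - a)) = (y + x) *+ 2.
  by rewrite addrACA [x + a + _]addrACA subrr addr0 mulr2n addrACA.
by rewrite normrMn yx [leRHS]mulr2n.
Qed.

Definition clique (X : set V) :=
  X `<=` unit_sphere V /\ forall x y, X x -> X y -> aligned x y.

Lemma clique_add X w : clique X -> unit_sphere V w ->
  (forall x, X x -> aligned w x) -> clique (w |` X).
Proof.
move=> [XS Xa] Sw wX; split=> [x [->//|/XS//]|x y [->|xX] [->|yX]].
- exact: alignedxx.
- exact: wX.
- exact/aligned_sym/wX.
- exact: Xa.
Qed.

(** Zorn's lemma on the sets whose union with [{p, q}] is a clique. *)
Lemma maximal_clique p q : unit_sphere V p -> unit_sphere V q -> aligned p q ->
  exists G, [/\ clique G, G p, G q &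
    forall w, unit_sphere V w -> (forall g, G g -> aligned w g) -> G w].
Proof.
move=> Sp Sq pq.
have [|G [cG Gmax]] := @Zorn_bigcup V (fun X => clique (p |` (q |` X))).
  move=> F FP Ftot; split=> [x [->//|[->//|[X FX Xx]]]|].
    by have [XS _] := FP _ FX; apply: XS; right; right.
  (* This settles two points that both lie in [{p, q}], in particular the empty chain. *)
  have c0 : clique (p |` (q |` set0)).
    split=> [x [->//|[->//|[]]]|x y [->|[->|[]]] [->|[->|[]]]] //;
    first [exact: alignedxx|exact: aligned_sym].
  have pick x : (p |` (q |` \bigcup_(X in F) X)) x ->
      (p |` (q |` set0)) x \/ exists2 X, F X & X x.
    by move=> [->|[->|[X FX Xx]]]; [left; left|left; right; left|right; exists X].
  have weak X x : (p |` (q |` set0)) x -> (p |` (q |` X)) x.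
    by move=> [->|[->|[]]]; [left|right; left].
  move=> x y /pick[x0|[X FX Xx]] /pick[y0|[Y FY Yy]].
  - exact: c0.2.
  - by apply: (FP _ FY).2; [exact: weak|right; right].
  - by apply: (FP _ FX).2; [right; right|exact: weak].
  - have [XY|YX] := Ftot _ _ FX FY.
      by apply: (FP _ FY).2; right; right => //; exact: XY.
    by apply: (FP _ FX).2; right; right => //; exact: YX.
exists (p |` (q |` G)); split; [by []|by left|by right; left|].
move=> w Sw wG; apply: contrapT => nGw; apply: (Gmax (w |` G)).
  split=> [x Gx|]; first by right.
  by move=> /(_ w (or_introl erefl)) Gw; apply: nGw; right; right.
have -> : p |` (q |` (w |` G)) = w |` (p |` (q |` G)) 
  by rewrite (setUCA [set q]) setUCA.
exact: clique_add.
Qed.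

End Alignment.

Section ExposedInvariance.
Variables (K : numFieldType) (V : normedModType K).

(** Exposedness is expressed by sums and norms alone. Only additivity is asked, so that the
    conjugate-linear involution qualifies. *)
Lemma exposed_linear_isometry (L L' : V -> V) :
  {morph L : x y / x + y} -> {morph L' : x y / x + y} ->
  {mono L : x / `|x|} -> {mono L' : x / `|x|} -> cancel L L' -> cancel L' L ->
  forall x, exposed x -> exposed (L x).
Proof.
move=> LD LD' Ln Ln' LK LK' x [Sx ex]; split; first by rewrite /unit_sphere /= Ln.
move=> z Sz hz; apply: (can_inj LK'); rewrite LK; apply: ex.
  by rewrite /unit_sphere /= Ln'.
move=> y Sy yx; rewrite /aligned -Ln LD LK'; apply: hz.
  by rewrite /unit_sphere /= Ln.
by rewrite /aligned -LD Ln.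
Qed.

End ExposedInvariance.

(** * Mutually inverse isometries of unit spheres *)

Section SphericalIsometry.
Variable K : numFieldType.
Implicit Types V W : normedModType K.

Definition spherical_isometry V W (T : V -> W) :=
  (forall x, unit_sphere V x -> unit_sphere W (T x)) /\
  (forall x y, unit_sphere V x -> unit_sphere V y -> `|T x - T y| = `|x - y|).

Lemma unit_sphereN V (x : V) : unit_sphere V x -> unit_sphere V (- x).
Proof. by rewrite /unit_sphere /= normrN. Qed.

Lemma spherical_isometry_aligned V W (T : V -> W) (S : W -> V) :
  spherical_isometry T -> spherical_isometry S ->
  (forall y, unit_sphere W y -> T (S y) = y) ->
  forall x y, unit_sphere V x -> unit_sphere V y ->
  aligned x y -> aligned (T x) (T y).
Proof.
move=> [TS Ti] [SS Si] TK y z Sy Sz yz.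
pose T' x := - T (- x).
have T'S x : unit_sphere V x -> unit_sphere W (T' x).
  by move=> Sx; apply/unit_sphereN/TS/unit_sphereN.
have TT' a b : unit_sphere V a -> unit_sphere V b ->
    `|T a + T' b| = `|a + b|.
  by move=> Sa Sb; rewrite Ti ?opprK//; exact: unit_sphereN.
have T'K g : unit_sphere W g -> exists2 a, unit_sphere V a & T' a = g.
  move=> Sg; exists (- S (- g)); first exact/unit_sphereN/SS/unit_sphereN.
  by rewrite /T' opprK TK ?opprK//; exact: unit_sphereN.
set x := 2^-1 *: (y + z).
have Sx : unit_sphere V x by exact: mid_sphere.
have [|G [[GS Ga] Gp Gq Gmax]] := maximal_clique (TS _ Sx) (T'S _ Sx).
  by rewrite /aligned TT'//; exact: alignedxx.
(* Every [g] in [G] is some [T' b]. As [g] is aligned with [T x], [b] is aligned with [x], hence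
   with [a]; so [g] is aligned with [T a], and maximality applies. *)
have key a : unit_sphere V a ->
    (forall w, unit_sphere V w -> aligned w x -> aligned w a) -> G (T a).
  move=> Sa ha; apply: Gmax => [|g Gg]; first exact: TS.
  have [b Sb bg] := T'K _ (GS _ Gg).
  rewrite -bg /aligned TT'// addrC; apply: ha => //.
  by rewrite /aligned addrC -TT'// bg; exact: Ga.
apply: Ga; apply: key => // w Sw.
  exact: aligned_mid.
by rewrite /x addrC; exact: aligned_mid.
Qed.

Lemma spherical_isometry_exposed V W (T : V -> W) (S : W -> V) :
  spherical_isometry T -> spherical_isometry S ->
  (forall x, unit_sphere V x -> S (T x) = x) ->
  (forall y, unit_sphere W y -> T (S y) = y) ->
  forall u, exposed u -> exposed (T u) /\ T (- u) = - T u.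
Proof.
move=> Ti Si SK TK u [Su eu].
have Tal := spherical_isometry_aligned Ti Si TK.
have Sal := spherical_isometry_aligned Si Ti SK.
have [[TS Td] [SS Sd]] := (Ti, Si).
have eTu : exposed (T u).
  split=> [|w Sw hw]; first exact: TS.
  rewrite -(TK _ Sw); congr T; apply: eu => [|y Sy yu]; first exact: SS.
  rewrite -(SK _ Sy); apply: Sal => //; first exact: TS.
  by apply: hw; [exact: TS|exact: Tal].
(* [- T (- u)] passes the test for [T u]: if [w] is aligned with [T u], then [S w] is aligned with
   [u], and [|w - T (- u)| = |S w + u| = 2]. *)
split=> //; apply: oppr_inj; rewrite opprK; apply: eTu.2.
  exact/unit_sphereN/TS/unit_sphereN.
move=> w Sw wu; rewrite -(TK _ Sw) /aligned addrC Td ?opprK//.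
- rewrite -[u]SK//; apply: Sal => //; exact: TS.
- exact: SS.
- exact: unit_sphereN.
Qed.

End SphericalIsometry.

(** * Square roots in a C*-algebra *)

#[local] Instance nc_ops (S : pzRingType) :
  @Ncring.Ring_ops S 0 1 +%R *%R (fun x y => x - y) (@GRing.opp S) eq := {}.

#[local] Instance nc_ring (S : pzRingType) :
  @Ncring.Ring S 0 1 +%R *%R (fun x y => x - y) (@GRing.opp S) eq (nc_ops S).
Proof.
split; first exact _.
- by move=> ? ? -> ? ? ->.
- by move=> ? ? -> ? ? ->.
- by move=> ? ? -> ? ? ->.
- by move=> ? ? ->.
- exact: (@add0r S).
- exact: (@addrC S).
- exact: (@addrA S).
- exact: (@mul1r S).
- exact: (@mulr1 S).
- exact: (@mulrA S).
- exact: (@mulrDl S).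
- exact: (fun x y z => @mulrDr S z x y).
- by [].
- exact: (@subrr S).
Qed.

(* The change exposes the carrier, from which the ring instance is inferred. *)
Ltac ncring :=
  match goal with A : cstarAlgType _ |- @eq _ ?x ?y =>
    change (@eq (cstar_sort A) x y) end;
  Ncring_tac.non_commutative_ring.

Local Notation "t *:r x" := ((t%:C)%C *: x) (at level 40, left associativity).

(** * The norm as a real number *)

Section RealNorm.
Variables (R : realType) (A : cstarAlgType R).
Implicit Types (x y a b c : A) (t s : R).

Definition nm x : R := complex.Re `|x|.

Lemma nmE x : `|x| = ((nm x)%:C)%C.
Proof. by rewrite RRe_real// normr_real. Qed.

Lemma nm_ge0 x : 0 <= nm x.
Proof. by rewrite -ler0c -nmE. Qed.

Lemma nm_eq0 x : nm x = 0 -> x = 0.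
Proof. by move=> h; apply: normr0_eq0; rewrite nmE h. Qed.

Lemma nm0 : nm 0 = 0.
Proof. by rewrite /nm normr0. Qed.

Lemma nmD x y : nm (x + y) <= nm x + nm y.
Proof. by rewrite -lecR rmorphD /= -!nmE ler_normD. Qed.

Lemma nmN x : nm (- x) = nm x.
Proof. by rewrite /nm normrN. Qed.

Lemma nmB x y : nm (x - y) <= nm x + nm y.
Proof. by rewrite -(nmN y) nmD. Qed.

Lemma nmBC x y : nm (x - y) = nm (y - x).
Proof. by rewrite -nmN opprB. Qed.

Lemma nmM x y : nm (x * y) <= nm x * nm y.
Proof. by rewrite -lecR rmorphM /= -!nmE ler_cstar_normM. Qed.

Lemma nmZ t x : nm (t *:r x) = `|t| * nm x.
Proof.
by apply: complexI; rewrite rmorphM /= -!nmE normrZ normc_def /= expr0n addr0 sqrtr_sqr.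
Qed.

Lemma nmZi x : nm ('i%C *: x) = nm x.
Proof.
by apply: complexI; rewrite -!nmE normrZ normc_def /= expr0n add0r expr1n sqrtr1 mul1r.
Qed.

Lemma nm1 : nm (1 : A) = 1.
Proof. by rewrite /nm cstar_norm1. Qed.

Lemma nm_starM x : nm (star x * x) = nm x ^+ 2.
Proof. by apply: complexI; rewrite rmorphXn /= -!nmE norm_starM. Qed.

Lemma nm_star x : nm (star x) = nm x.
Proof.
have le y : nm y <= nm (star y).
  have := nmM (star y) y; rewrite nm_starM expr2.
  have := nm_ge0 y; rewrite le_eqVlt => /orP[/eqP <- _|y0]; first exact: nm_ge0.
  by rewrite ler_pM2r.
by apply/eqP; rewrite eq_le le -{2}[x]starK le.
Qed.

Lemma star0 : star (0 : A) = 0.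
Proof. by apply: (addrI (star 0)); rewrite -starD !addr0. Qed.

Lemma starN x : star (- x) = - star x.
Proof. by apply: (addrI (star x)); rewrite -starD !subrr star0. Qed.

Lemma starB x y : star (x - y) = star x - star y.
Proof. by rewrite starD starN. Qed.

Lemma starZr t x : star (t *:r x) = t *:r star x.
Proof. by rewrite starZ conjc_real. Qed.

Lemma starZi x : star ('i%C *: x) = - ('i%C *: star x).
Proof. by rewrite starZ -scaleNr; congr (_ *: _); apply/eqP; rewrite eq_complex /= oppr0 !eqxx. Qed.

Lemma nm_complete (u : nat -> A) (g : nat -> R) :
  (forall m n, (m <= n)%N -> nm (u n - u m) <= g m) ->
  (forall e, 0 < e -> exists n, g n < e) ->
  exists l, forall n, nm (l - u n) <= g n.
Proof.
move=> ug g0.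
have cu : cvg (u @ \oo).
  apply/cauchy_cvgP/cauchy_exP => e e0.
  have -> : e = ((complex.Re e)%:C)%C by rewrite RRe_real// gtr0_real.
  have [|n gn] := g0 (complex.Re e); first by move: e0; rewrite ltcE => /andP[].
  exists (u n); exists n => // m /= nm_.
  rewrite -ball_normE /ball_ /= nmE ltcR nmBC.
  exact: le_lt_trans (ug _ _ nm_) gn.
exists (lim (u @ \oo)) => n; apply/ler_addgt0Pl => e e0.
have /cvgrPdist_lt/(_ (e%:C)%C) := cu; rewrite ltcR => /(_ e0)[N _ hN].
have := hN (maxn N n) (leq_maxl _ _); rewrite nmE ltcR => h.
apply: le_trans (_ : nm (lim (u @ \oo) - u (maxn N n)) + nm (u (maxn N n) - u n) <= _).
  by rewrite (le_trans _ (nmD _ _))// addrA subrK.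
by have := ug n (maxn N n) (leq_maxr _ _); move: h; lra.
Qed.

End RealNorm.

Section SquareRoot.
Variables (R : realType) (A : cstarAlgType R).
Implicit Types (x y a b c : A) (t s : R).

(* [sqrt_iter a] solves [b = (a + b^2) / 2], for which [1 - b] is a square root
   of [1 - a]; it is dominated by [sqrt_bound], the scalar case [a = 1]. *)
Fixpoint sqrt_bound (n : nat) : R :=
  if n is m.+1 then 2^-1 * (1 + sqrt_bound m ^+ 2) else 0.

Fixpoint sqrt_iter a (n : nat) : A :=
  if n is m.+1 then 2^-1 *:r (a + sqrt_iter a m * sqrt_iter a m) else 0.

Lemma sqrt_bound_itv n : 0 <= sqrt_bound n <= 1.
Proof.
elim: n => [|n /andP[h0 h1]] /=; first by rewrite lexx ler01.
by apply/andP; split; nra.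
Qed.

Lemma sqrt_bound_le m n : (m <= n)%N -> sqrt_bound m <= sqrt_bound n.
Proof.
move=> /subnK <-; elim: (n - m)%N => //= k; rewrite /= -/addn => IH.
apply: (le_trans IH); have /andP[] := sqrt_bound_itv (k + m).
by move: (sqrt_bound _) => b; nra.
Qed.

(** One step turns the gap [d = 1 - sqrt_bound n] into [d - d^2 / 2]. If it never fell below [e], it
    would lose [e^2 / 2] each time and become negative. *)
Lemma sqrt_bound_cvg e : 0 < e -> exists n, 1 - sqrt_bound n < e.
Proof.
move=> e0; apply: contrapT => /forallNP h.
have {}h n : e <= 1 - sqrt_bound n by rewrite leNgt; apply/negP/h.
have lin n : 1 - sqrt_bound n <= 1 - n%:R * (e ^+ 2 / 2).
  elim: n => [|n IH] /=; first by rewrite mul0r.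
  have := h n; move: IH; rewrite -[n.+1%:R]natr1; move: (sqrt_bound n) (n%:R) => b k h1 h2.
  have : e ^+ 2 <= (1 - b) ^+ 2 by nra.
  by rewrite mulrDl; lra.
pose n := Num.bound (2 / e ^+ 2).
have : 2 / e ^+ 2 < n%:R by rewrite archi_boundP// divr_ge0// exprn_ge0// ltW.
have e2 : 0 < e ^+ 2 by rewrite exprn_gt0.
rewrite ltr_pdivrMr// => hn.
by have := lin n; have := h n; nra.
Qed.

Lemma le_small s t : (forall n, s <= t + (1 - sqrt_bound n)) -> s <= t.
Proof.
move=> h; apply/ler_addgt0Pr => e /sqrt_bound_cvg[n hn].
by apply: le_trans (h n) _; rewrite lerD2l ltW.
Qed.

Lemma eq0_small x s : (forall n, nm x <= s * (1 - sqrt_bound n)) -> x = 0.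
Proof.
move=> h; apply: nm_eq0; apply/eqP; rewrite eq_le nm_ge0 andbT.
apply: le_small => n; rewrite add0r; move: n.
have s1 : 0 < `|s| + 1 by rewrite ltr_wpDl.
suff : nm x / (`|s| + 1) <= 0.
  rewrite pmulr_lle0 ?invr_gt0// => h0 n; rewrite (le_trans h0)// subr_ge0.
  by case/andP: (sqrt_bound_itv n).
apply: le_small => n; rewrite add0r ler_pdivrMr//.
apply: (le_trans (h n)); rewrite mulrC ler_wpM2l//.
  by rewrite subr_ge0; case/andP: (sqrt_bound_itv n).
by rewrite (le_trans (ler_norm _))// lerDl.
Qed.

Lemma sub_mulxx x y : x * x - y * y = x * (x - y) + (x - y) * y.
Proof. by ncring. Qed.

Lemma nm_sub_mulxx x y : nm (x * x - y * y) <= (nm x + nm y) * nm (x - y).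
Proof.
rewrite sub_mulxx [leRHS]mulrDl (le_trans (nmD _ _))// lerD// ?nmM//.
by rewrite mulrC nmM.
Qed.

Lemma nm_sqrt_iter a n : nm a <= 1 -> nm (sqrt_iter a n) <= sqrt_bound n.
Proof.
move=> a1; elim: n => [|n IH] /=; first by rewrite nm0.
rewrite nmZ ger0_norm ?invr_ge0// ler_wpM2l ?invr_ge0//.
apply: le_trans (nmD _ _) _; rewrite lerD// (le_trans (nmM _ _))//.
by rewrite expr2 ler_pM// nm_ge0.
Qed.

(** The increments obey the scalar recursion, because [x x - y y] splits as [x (x - y) + (x - y) y]
    without commutativity. *)
Lemma nm_sqrt_iterS a n : nm a <= 1 ->
  nm (sqrt_iter a n.+1 - sqrt_iter a n) <= sqrt_bound n.+1 - sqrt_bound n.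
Proof.
move=> a1; elim: n => [|n IH].
  rewrite /= !mulr0 !subr0 addr0 expr0n addr0 mulr1 nmZ ger0_norm ?invr_ge0//.
  by rewrite -[leRHS]mulr1 ler_wpM2l ?invr_ge0.
set x := sqrt_iter a n.+1 in IH *; set y := sqrt_iter a n in IH *.
have -> : sqrt_iter a n.+2 - x = 2^-1 *:r (x * x - y * y).
  by rewrite {2}/x /= -/x -/y -scalerBr opprD addrACA subrr add0r.
rewrite nmZ ger0_norm ?invr_ge0//.
have -> : sqrt_bound n.+2 - sqrt_bound n.+1 = 2^-1 *
    ((sqrt_bound n.+1 + sqrt_bound n) * (sqrt_bound n.+1 - sqrt_bound n)).
  by rewrite /=; ring.
rewrite ler_wpM2l ?invr_ge0// (le_trans (nm_sub_mulxx _ _))//.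
by rewrite ler_pM ?addr_ge0 ?nm_ge0// lerD// nm_sqrt_iter.
Qed.

Lemma nm_sqrt_iterB a m n : nm a <= 1 -> (m <= n)%N ->
  nm (sqrt_iter a n - sqrt_iter a m) <= 1 - sqrt_bound m.
Proof.
move=> a1 mn; apply: (@le_trans _ _ (sqrt_bound n - sqrt_bound m)); last first.
  by rewrite lerD2r; case/andP: (sqrt_bound_itv n).
move: mn => /subnK <-; elim: (n - m)%N => [|k IH]; first by rewrite add0n !subrr nm0.
rewrite addSn -(subrKA (sqrt_iter a (k + m))) -(subrKA (sqrt_bound (k + m))).
by rewrite (le_trans (nmD _ _))// lerD// nm_sqrt_iterS.
Qed.

(** The limit of [sqrt_iter a], chosen through its rate of convergence; for [a] of norm at most 1
    the default 0 is never taken for want of a limit. *)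
Definition sqrtb a : A :=
  xget 0 [set l | forall n, nm (l - sqrt_iter a n) <= 1 - sqrt_bound n].

(* Meaningful for [a] of norm at most 1 only. *)
Definition sqrt1B a : A := 1 - sqrtb a.

Lemma sqrtbP a n : nm a <= 1 -> nm (sqrtb a - sqrt_iter a n) <= 1 - sqrt_bound n.
Proof.
move=> a1; rewrite /sqrtb; case: xgetP => [l _ /= //|none]; exfalso.
have [||l hl] := @nm_complete R A (sqrt_iter a) (fun n => 1 - sqrt_bound n).
- by move=> i j; exact: nm_sqrt_iterB.
- exact: sqrt_bound_cvg.
- exact: none hl.
Qed.

Lemma nm_sqrtb_le1 a : nm a <= 1 -> nm (sqrtb a) <= 1.
Proof. by move=> /(sqrtbP 0) /=; rewrite !subr0. Qed.

Lemma sqrtbE a : nm a <= 1 -> sqrtb a + sqrtb a = a + sqrtb a * sqrtb a.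
Proof.
(* The 4 counts two gaps from approximating both summands [b] and two from [b b - y y]. *)
move=> a1; apply/eqP; rewrite -subr_eq0; apply/eqP; apply: (@eq0_small _ 4) => n.
have e1 := sqrtbP n.+1 a1; have e2 := sqrtbP n a1.
have b1 := nm_sqrtb_le1 a1; have y1 := nm_sqrt_iter n a1.
set b := sqrtb a in e1 e2 b1 *; set y := sqrt_iter a n in e2 y1 *.
have -> : b + b - (a + b * b) = (b - sqrt_iter a n.+1) + (b - sqrt_iter a n.+1) - (b * b - y * y).
  have ea : a = sqrt_iter a n.+1 + sqrt_iter a n.+1 - y * y.
    by rewrite /= -scalerDl -rmorphD /= -mulr2n -[_ *+ 2]mulr_natl mulfV// scale1r addrK.
  move: ea; move: (sqrt_iter a n.+1) => z ea.
  by move: b y ea {e1 e2 b1 y1} => b y ea; rewrite ea; ncring.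
have := nm_sub_mulxx b y; move: y1.
have := sqrt_bound_le (leqnSn n); move: b1.
have /andP[] := sqrt_bound_itv n; have := nm_ge0 (b - y).
have := nmB (b - sqrt_iter a n.+1 + (b - sqrt_iter a n.+1)) (b * b - y * y).
have := nmD (b - sqrt_iter a n.+1) (b - sqrt_iter a n.+1).
move: e1 e2; rewrite -/b -/y.
set p := nm (_ + _ - _); set q := nm (_ + _); set r := nm (b - sqrt_iter _ _).
set v := nm (b * b - _); set w := nm (b - y); set bb := sqrt_bound n.+1; set cc := sqrt_bound n.
move=> e1 e2 h1 h2 h3 h4 h5 h6 h7 h8 h9.
have : (nm b + nm y) * w <= 2 * w by rewrite ler_wpM2r//; lra.
lra.
Qed.

(** The relation passes to the iterates, which are polynomials in [a], and then to the limit.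
    Besides commutation it yields [x sqrt (1 - x^* x) = sqrt (1 - x x^* ) x]. *)
Lemma sqrtb_intertwine a a' c : nm a <= 1 -> nm a' <= 1 ->
  c * a = a' * c -> c * sqrtb a = sqrtb a' * c.
Proof.
move=> a1 a1' h; apply/eqP; rewrite -subr_eq0; apply/eqP.
apply: (@eq0_small _ (2 * nm c)) => n.
have hn : c * sqrt_iter a n = sqrt_iter a' n * c.
  elim: n => [|n IH] /=; first by rewrite mulr0 mul0r.
  by rewrite -scalerAr -scalerAl mulrDr mulrDl h mulrA IH -!mulrA IH.
have -> : c * sqrtb a - sqrtb a' * c =
    c * (sqrtb a - sqrt_iter a n) - (sqrtb a' - sqrt_iter a' n) * c.
  by rewrite mulrBr mulrBl hn; ncring.
apply: le_trans (nmB _ _) _.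
have := sqrtbP n a1; have := sqrtbP n a1'; have := nm_ge0 c.
have := nmM c (sqrtb a - sqrt_iter a n); have := nmM (sqrtb a' - sqrt_iter a' n) c.
nra.
Qed.

Lemma star_sqrtb a : nm a <= 1 -> star a = a -> star (sqrtb a) = sqrtb a.
Proof.
move=> a1 sa; apply/eqP; rewrite -subr_eq0; apply/eqP.
apply: (@eq0_small _ 2) => n.
have hn : star (sqrt_iter a n) = sqrt_iter a n.
  by elim: n => [|n IH] /=; rewrite ?star0// starZr starD starM sa IH.
have -> : star (sqrtb a) - sqrtb a = star (sqrtb a - sqrt_iter a n) - (sqrtb a - sqrt_iter a n).
  by rewrite starB hn; ncring.
apply: le_trans (nmB _ _) _; rewrite nm_star; have := sqrtbP n a1; lra.
Qed.

(** This makes [sqrt1B a] close to 1 for small [a]. The recursion preserves the bound since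
    [(s + s^2) / 2 <= s] for [s = nm a <= 1]. *)
Lemma nm_sqrtb a : nm a <= 1 -> nm (sqrtb a) <= nm a.
Proof.
move=> a1; apply: le_small => n.
have hn : nm (sqrt_iter a n) <= nm a.
  elim: n => [|n IH] /=; first by rewrite nm0 nm_ge0.
  rewrite nmZ ger0_norm ?invr_ge0//.
  have := nmD a (sqrt_iter a n * sqrt_iter a n).
  have := nmM (sqrt_iter a n) (sqrt_iter a n); have := nm_ge0 (sqrt_iter a n); nra.
have := nmD (sqrtb a - sqrt_iter a n) (sqrt_iter a n); rewrite subrK.
have := sqrtbP n a1; lra.
Qed.

Lemma sqrt1B_sqr a : nm a <= 1 -> sqrt1B a * sqrt1B a = 1 - a.
Proof.
move=> /sqrtbE h; rewrite /sqrt1B.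
have -> : (1 - sqrtb a) * (1 - sqrtb a) = 1 - (sqrtb a + sqrtb a) + sqrtb a * sqrtb a by ncring.
rewrite h; ncring.
Qed.

Lemma sqrt1B_intertwine a a' c : nm a <= 1 -> nm a' <= 1 ->
  c * a = a' * c -> c * sqrt1B a = sqrt1B a' * c.
Proof.
move=> a1 a1' h; rewrite /sqrt1B mulrBr mulrBl mulr1 mul1r.
by rewrite (sqrtb_intertwine a1 a1' h).
Qed.

Lemma star_sqrt1B a : nm a <= 1 -> star a = a -> star (sqrt1B a) = sqrt1B a.
Proof. by move=> a1 sa; rewrite /sqrt1B starB star1 star_sqrtb. Qed.

Lemma sqrt1B0 : sqrt1B 0 = 1.
Proof.
rewrite /sqrt1B (_ : sqrtb 0 = 0) ?subr0//; apply: nm_eq0; apply/eqP.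
by rewrite eq_le nm_ge0 andbT -(nm0 A) nm_sqrtb// nm0.
Qed.

End SquareRoot.

(** * Positive elements *)

Section Positivity.
Variables (R : realType) (A : cstarAlgType R).
Implicit Types (h k m n w x y a b c u : A) (s t : R).

Lemma scalerrA s t x : s *:r (t *:r x) = (s * t) *:r x.
Proof. by rewrite scalerA -rmorphM. Qed.

Lemma scalerrDl s t x : (s + t) *:r x = s *:r x + t *:r x.
Proof. by rewrite -scalerDl -rmorphD. Qed.

Lemma scalerrBl s t x : (s - t) *:r x = s *:r x - t *:r x.
Proof. by rewrite -scalerBl -rmorphB. Qed.

Lemma scale1rr x : 1 *:r x = x.
Proof. by rewrite rmorph1 scale1r. Qed.

Lemma scalerrMM s t x y : (s *:r x) * (t *:r y) = (s * t) *:r (x * y).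
Proof. by rewrite -scalerAl -scalerAr scalerrA. Qed.

Lemma scalerr_inj t x : t != 0 -> t *:r x = 0 -> x = 0.
Proof.
move=> t0 /(congr1 ( *:%R (t^-1%:C)%C)); rewrite scaler0 scalerrA mulVf//.
by rewrite scale1rr.
Qed.

Lemma scaleiMM x y : ('i%C *: x) * ('i%C *: y) = - (x * y).
Proof. by rewrite -scalerAl -scalerAr scalerA -expr2 sqr_i scaleN1r. Qed.

Lemma addxx_eq0 x : x + x = 0 -> x = 0.
Proof.
rewrite -[x in x + _]scale1rr -[x in _ + x]scale1rr -scalerrDl.
by apply: scalerr_inj; rewrite gt_eqF ?addr_gt0.
Qed.

Lemma star_sqr_eq0 x : star x * x = 0 -> x = 0.
Proof.
move=> h; apply: nm_eq0; have := nm_starM x; rewrite h nm0 => /esym/eqP.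
by rewrite sqrf_eq0 => /eqP.
Qed.

Lemma sa_sqr_eq0 x : star x = x -> x * x = 0 -> x = 0.
Proof. by move=> sx; rewrite -{1}sx; exact: star_sqr_eq0. Qed.

Lemma star_parts a b : star a = a -> star b = b ->
  star (a + 'i%C *: b) = a - 'i%C *: b.
Proof. by move=> sa sb; rewrite starD starZi sa sb. Qed.

Lemma star_parts_sqr a b : star a = a -> star b = b -> a * b = b * a ->
  star (a + 'i%C *: b) * (a + 'i%C *: b) = a * a + b * b.
Proof.
move=> sa sb ab; rewrite star_parts// mulrDr !mulrBl scaleiMM -scalerAl -scalerAr ab.
by rewrite opprK addrA subrK.
Qed.

(** [u = a + i b] satisfies [u^* u = 1], so it has norm 1, and [a] and [b] are its real and
    imaginary parts. *)
Lemma nm_parts a b : star a = a -> star b = b -> a * b = b * a ->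
  a * a + b * b = 1 -> nm a <= 1 /\ nm b <= 1.
Proof.
move=> sa sb ab ab1; set u := a + 'i%C *: b.
have u1 : nm u = 1.
  apply/eqP; rewrite -(@pexpr_eq1 _ _ 2)// ?nm_ge0// -nm_starM.
  by rewrite star_parts_sqr// ab1 nm1.
have dbl x : nm (x + x) = 2 * nm x.
  by rewrite -[in LHS](scale1rr x) -scalerrDl nmZ ger0_norm.
split.
  have := nmD u (star u); rewrite nm_star u1 star_parts//.
  by rewrite /u addrACA subrr addr0 dbl; lra.
have := nmB u (star u); rewrite nm_star u1 star_parts//.
have -> : u - (a - 'i%C *: b) = 'i%C *: b + 'i%C *: b by rewrite /u; ncring.
by rewrite dbl nmZi; lra.
Qed.

(** Positivity without spectra: for self-adjoint [h] the bound confines the spectrum to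
    [[0, 2 s]]. *)
Definition pos h := star h = h /\ exists s, nm (s *:r 1 - h) <= s.

Lemma pos_ub h : pos h -> exists2 s, 0 < s &
  forall t, s <= t -> nm (t *:r 1 - h) <= t.
Proof.
case=> _ [s hs]; exists (`|s| + 1) => [|t st]; first by rewrite ltr_wpDl.
have {}st : s <= t by have := ler_norm s; lra.
have -> : t *:r 1 - h = (t - s) *:r 1 + (s *:r 1 - h) by rewrite scalerrBl addrA subrK.
apply: le_trans (nmD _ _) _; rewrite nmZ nm1 ger0_norm; lra.
Qed.

Lemma posD h k : pos h -> pos k -> pos (h + k).
Proof.
move=> ph pk; have [s _ hs] := pos_ub ph; have [t _ ht] := pos_ub pk.
split; first by rewrite starD ph.1 pk.1.
exists (s + t); rewrite scalerrDl opprD addrACA.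
by rewrite (le_trans (nmD _ _))// lerD ?hs ?ht.
Qed.

Lemma posZ t h : 0 <= t -> pos h -> pos (t *:r h).
Proof.
move=> t0 [sh [s hs]]; split; first by rewrite starZr sh.
by exists (t * s); rewrite -scalerrA -scalerBr nmZ ger0_norm// ler_wpM2l.
Qed.

Lemma nm_le_pos h s : star h = h -> nm h <= s -> pos (s *:r 1 - h).
Proof.
move=> sh hs; split; first by rewrite starB starZr star1 sh.
by exists s; rewrite opprB addrC subrK.
Qed.

Lemma pos1 : pos 1.
Proof. by split; [rewrite star1|exists 1; rewrite scale1rr subrr nm0]. Qed.

Lemma pos_scalar t : 0 <= t -> pos (t *:r 1).
Proof. by move=> t0; apply: posZ => //; exact: pos1. Qed.

(** Write [h = s (1 - k)] with [k] of norm at most 1 and take the root of each factor. *)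
Lemma pos_sqrt h : pos h -> exists m, [/\ star m = m, m * m = h, pos m &
  forall c, c * h = h * c -> c * m = m * c].
Proof.
move=> ph; have [s s0 /(_ _ (lexx s)) hs] := pos_ub ph; have sh := ph.1.
pose k := 1 - s^-1 *:r h.
have k1 : nm k <= 1.
  have -> : k = s^-1 *:r (s *:r 1 - h) by rewrite scalerBr scalerrA mulVf ?scale1rr// gt_eqF.
  by rewrite nmZ gtr0_norm ?invr_gt0// ler_pdivrMl// mulr1.
have sk : star k = k by rewrite starB star1 starZr sh.
have sqm : star (sqrt1B k) = sqrt1B k by exact: star_sqrt1B.
exists (Num.sqrt s *:r sqrt1B k); split.
- by rewrite starZr sqm.
- rewrite scalerrMM sqrt1B_sqr// -expr2 sqr_sqrtr ?ltW// /k opprB addrC subrK.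
  by rewrite scalerrA mulfV ?scale1rr// gt_eqF.
- apply: posZ; first exact: sqrtr_ge0.
  split=> //; exists 1; rewrite scale1rr /sqrt1B opprB addrC subrK.
  exact: nm_sqrtb_le1.
- move=> c hc; rewrite -scalerAr -scalerAl; congr (_ *: _).
  apply: sqrt1B_intertwine => //.
  by rewrite /k mulrBr mulrBl mulr1 mul1r -scalerAr -scalerAl hc.
Qed.

(** Scale [a] to [b] of norm at most 1. Then [c = sqrt1B (b * b)] commutes with [b] and
    [b^2 + c^2 = 1], so [nm_parts] bounds [c], hence [1 - b^2 = c^2]. *)
Lemma pos_sqr a : star a = a -> pos (a * a).
Proof.
move=> sa; pose t := nm a + 1; have t0 : 0 < t by rewrite /t ltr_wpDl ?nm_ge0.
pose b := t^-1 *:r a.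
have sb : star b = b by rewrite starZr sa.
have -> : a = t *:r b by rewrite scalerrA mulfV ?scale1rr// gt_eqF.
rewrite scalerrMM; apply: posZ; first by rewrite mulr_ge0// ltW.
have b1 : nm b <= 1.
  rewrite nmZ gtr0_norm ?invr_gt0// ler_pdivrMl// mulr1 /t.
  by rewrite lerDl.
have bb1 : nm (b * b) <= 1.
  by rewrite (le_trans (nmM _ _))// -[leRHS]mulr1 ler_pM// nm_ge0.
have sbb : star (b * b) = b * b by rewrite starM sb.
split=> //; exists 1; rewrite scale1rr -sqrt1B_sqr//.
have [] // := @nm_parts b (sqrt1B (b * b)).
- exact: star_sqrt1B.
- by apply: sqrt1B_intertwine => //; rewrite mulrA.
- by rewrite sqrt1B_sqr// addrC subrK.
move=> _ h; rewrite (le_trans (nmM _ _))// -[leRHS]mulr1 ler_pM// nm_ge0//.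
Qed.

(** With commuting roots [m] of [h] and [n] of [- h], the element [n + i m] has modulus squared
    [n^2 + m^2 = 0]; so it vanishes together with its real part [n]. *)
Lemma pos_anti h : pos h -> pos (- h) -> h = 0.
Proof.
move=> /pos_sqrt[m [sm mm _ _]] /pos_sqrt[n [sn nn _ cn]].
have mn : n * m = m * n.
  by rewrite cn// -mm mulrN mulNr mulrA.
have n0 : n + 'i%C *: m = 0.
  by apply: star_sqr_eq0; rewrite star_parts_sqr// mm nn addrC subrr.
have : star (n + 'i%C *: m) = 0 by rewrite n0 star0.
rewrite star_parts// => n1.
have /addxx_eq0 n2 : n + n = 0.
  have -> : n + n = (n + 'i%C *: m) + (n - 'i%C *: m) by rewrite addrACA subrr addr0.
  by rewrite n0 n1 addr0.
by apply: oppr_inj; rewrite -nn n2 mul0r oppr0.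
Qed.

(** Up to a positive factor this is the sum of the squares of the real and imaginary parts of
    [x]. *)
Lemma pos_starMD x : pos (star x * x + x * star x).
Proof.
pose a := x + star x; pose b := 'i%C *: (x - star x).
have -> : star x * x + x * star x = 2^-1 *:r (a * a + b * b).
  have -> : a * a + b * b = (star x * x + x * star x) + (star x * x + x * star x).
    by rewrite scaleiMM /a; ncring.
  by rewrite scalerDr -scalerrDl -[LHS]scale1rr; congr (_%:C%C *: _); lra.
apply: posZ; first by rewrite invr_ge0.
apply: posD; apply: pos_sqr; first by rewrite /a starD starK addrC.
by rewrite /b starZi starB starK -scalerN opprB.
Qed.

Lemma pos_NstarM_eq0 x : pos (- (star x * x)) -> x = 0.
Proof.
(* If [- w w^*] is positive, so is [w^* w = (w^* w + w w^* ) - w w^*]. This is applied to [w = x m],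
   where [m^2 = - x^* x]: the two negated products are [m^4] and [(x x^* )^2]. *)
have two w : pos (- (star w * w)) -> pos (- (w * star w)) -> w = 0.
  move=> h1 h2; apply: star_sqr_eq0; apply: pos_anti => //.
  by have := posD (pos_starMD w) h2; rewrite addrK.
move=> /pos_sqrt[m [sm mm _ _]].
have xx : star x * x = - (m * m) by rewrite mm opprK.
have sqsa a : star a = a -> star (a * a) = a * a by move=> sa; rewrite starM sa.
have sxx : star (x * star x) = x * star x by rewrite starM starK.
have xm0 : x * m = 0.
  apply: two; rewrite starM sm.
    have -> : m * star x * (x * m) = m * (star x * x) * m by rewrite !mulrA.
    have -> : - (m * (star x * x) * m) = (m * m) * (m * m) by rewrite xx; ncring.
    exact/pos_sqr/sqsa.
  have -> : - (x * m * (m * star x)) = x * - (m * m) * star x by ncring.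
  rewrite -xx !mulrA -mulrA; exact: pos_sqr.
have /sa_sqr_eq0 : m * m * (m * m) = 0.
  have -> : m * m * (m * m) = m * (- (star x * x)) * m by rewrite -mm !mulrA.
  by rewrite mulrN mulNr -!mulrA xm0 !mulr0 oppr0.
rewrite sqsa// => /(_ erefl) m0; apply: star_sqr_eq0.
by rewrite xx m0 oppr0.
Qed.

(* [h = star x * x], [r = |h|], [w = r - h] is twice the negative part of [h]. *)
Lemma pos_starM x : pos (star x * x).
Proof.
set h := star x * x.
have sh : star h = h by rewrite starM starK.
have [r [sr rr /pos_sqrt[k [sk kk _ ck]] cr]] := pos_sqrt (pos_sqr sh).
have hr : h * r = r * h by apply: cr; rewrite mulrA.
have hk : h * k = k * h by exact: ck.
have kr : r * k = k * r by exact: ck.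
pose w := r - h.
have sw : star w = w by rewrite starB sr sh.
have kw : w * k = k * w by rewrite mulrBl mulrBr hk kr.
have skw : star (k * w) = k * w by rewrite starM sk sw kw.
have ww : w * w = r * w + r * w.
  have -> : w * w = r * r + h * h - r * h - h * r by rewrite /w; ncring.
  by rewrite -rr hr /w; ncring.
have whw : star (x * w) * (x * w) = - (k * w * (k * w)).
  rewrite starM sw -kw; have -> : w * star x * (x * w) = w * (h * w) by rewrite !mulrA.
  have -> : h * w = - (r * w) by rewrite /w mulrBr -rr hr; ncring.
  by rewrite -kk [in RHS]kw mulrN !mulrA kw.
have xw0 : x * w = 0.
  by apply: pos_NstarM_eq0; rewrite whw opprK; exact: pos_sqr.
have kw0 : k * w = 0.
  apply: sa_sqr_eq0 => //; apply: oppr_inj; rewrite -whw xw0.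
  by rewrite mulr0 oppr0.
have w0 : w = 0.
  by apply: sa_sqr_eq0 => //; rewrite ww -kk -mulrA kw0 mulr0 addr0.
have <- : r = h by apply/eqP; rewrite -subr_eq0 -/w w0.
by rewrite -kk; exact: pos_sqr.
Qed.

Lemma pos_conj h x : pos h -> pos (star x * h * x).
Proof.
move=> /pos_sqrt[m [sm <- _ _]].
have -> : star x * (m * m) * x = star (m * x) * (m * x) by rewrite starM sm !mulrA.
exact: pos_starM.
Qed.

(** Commuting roots of [h / s] and [1 - h / s] have squares adding up to 1, so [nm_parts] bounds
    them. *)
Lemma pos_nm_le h s : 0 < s -> pos h -> pos (s *:r 1 - h) -> nm h <= s.
Proof.
move=> s0 /pos_sqrt[m [sm mm _ _]] /pos_sqrt[n [sn nn _ cn]].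
have mn : m * n = n * m.
  by apply: cn; rewrite -mm mulrBr mulrBl -scalerAr -scalerAl mulr1 mul1r mulrA.
pose t := (Num.sqrt s)^-1.
have tt : t * t = s^-1 by rewrite -expr2 exprVn sqr_sqrtr ?ltW.
have [||||m1 _] := @nm_parts (t *:r m) (t *:r n).
- by rewrite starZr sm.
- by rewrite starZr sn.
- by rewrite !scalerrMM mn.
- rewrite !scalerrMM -scalerDr mm nn addrC subrK tt scalerrA mulVf ?scale1rr//.
  by rewrite gt_eqF.
have : nm ((t *:r m) * (t *:r m)) <= 1.
  by rewrite (le_trans (nmM _ _))// -[leRHS]mulr1 ler_pM// nm_ge0.
rewrite scalerrMM tt mm nmZ gtr0_norm ?invr_gt0//.
by rewrite ler_pdivrMl// mulr1.
Qed.

End Positivity.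

(** * Exposed points of the sphere of a C*-algebra *)

Section Exposed.
Variables (R : realType) (A : cstarAlgType R).
Implicit Types (b c u x y z : A) (s t : R).

Lemma unit_sphereE x : unit_sphere A x <-> nm x = 1.
Proof. by rewrite /unit_sphere /= nmE; split=> [/complexI//|->]. Qed.

Lemma alignedE x y : aligned x y <-> nm (x + y) = 2.
Proof.
rewrite /aligned nmE -(rmorph_nat (real_complex R)).
by split=> [/complexI//|->].
Qed.

(** If [t = nm (y + 1)] were below 2, then [y <= t - 1 < 1], against [nm y = 1]. The maximum with
    1/2 keeps [s] positive. *)
Lemma nm_pos_add1 y : pos y -> nm y = 1 -> nm (y + 1) = 2.
Proof.
move=> py ny; apply/eqP; rewrite eq_le; apply/andP; split.
  by have := nmD y 1; rewrite nm1 ny.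
rewrite leNgt; apply/negP; set t := nm (y + 1) => t2.
have pt : pos (t *:r 1 - (y + 1)).
  by apply: nm_le_pos => //; rewrite starD star1 py.1.
pose s := Num.max (t - 1) 2^-1.
have s0 : 0 < s by rewrite lt_max invr_gt0 ltr0n orbT.
have s1 : s < 1 by rewrite gt_max; apply/andP; split; lra.
have ps : pos (s *:r 1 - y).
  have -> : s *:r 1 - y = (s - (t - 1)) *:r 1 + (t *:r 1 - (y + 1)).
    by rewrite !scalerrBl scale1rr; ncring.
  by apply: posD => //; apply: pos_scalar; rewrite subr_ge0 le_max lexx.
by have := pos_nm_le s0 py ps; rewrite ny; lra.
Qed.

(** For [z <> 1] the test point is [y], the multiple of [(1 - z)^* (1 - z)] of norm 1. Positivity
    aligns it with 1, so [c = z + y] has norm 2. In the combination of [e1] and [e2] below the terms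
    in [y] cancel, leaving [(3 + k / 2) C <= 12 + k]; but [nm C = 4] and [k > 0]. *)
Lemma exposed1 : exposed (1 : A).
Proof.
split; first exact/unit_sphereE/nm1.
move=> /= z /unit_sphereE nz hz; apply: contrapT => z1.
pose W := star (1 - z) * (1 - z); pose k := nm (1 - z) ^+ 2.
have k0 : 0 < k.
  rewrite exprn_gt0// lt_neqAle nm_ge0 andbT eq_sym; apply/eqP => /nm_eq0/eqP.
  by rewrite subr_eq0 => /eqP/esym.
pose y := k^-1 *:r W.
have py : pos y by apply: posZ; [rewrite invr_ge0 ltW|exact: pos_starM].
have sy := py.1.
have ny : nm y = 1 by rewrite nmZ nm_starM gtr0_norm ?invr_gt0// mulVf// gt_eqF.
have Wy : W = k *:r y by rewrite scalerrA mulfV ?scale1rr// gt_eqF.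
clearbody y.
have {hz} : nm (z + y) = 2.
  by apply/alignedE/hz; [exact/unit_sphereE|apply/alignedE; exact: nm_pos_add1].
set c := z + y => nc.
pose C := star c * c; pose D := star (y - z) * (y - z); pose Z := star z * z.
pose P := star (1 - y - (y - z)) * (1 - y - (y - z)).
have pD : pos D by exact: pos_starM.
have pP : pos P by exact: pos_starM.
have pZ : pos (1 - Z).
  rewrite -[1]scale1rr; apply: nm_le_pos; first by rewrite starM starK.
  by rewrite nm_starM nz expr1n.
have py1 : pos (1 - y) by rewrite -[1]scale1rr; apply: nm_le_pos; rewrite ?ny.
have pyy : pos (y - y * y).
  have [m [sm mm _ _]] := pos_sqrt py.
  have -> : y - y * y = star m * (1 - y) * m by rewrite sm -mm; ncring.
  exact: pos_conj.
pose d (x : A) : A := x + x.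
have pd x : pos x -> pos (d x) by move=> px; exact: posD.
(* Parallelogram law for [y] and [z]: [C + D = 2 Z + 2 y^2]. *)
have e1 : 2 *:r (y + 1) - C = d (y - y * y) + d (1 - Z) + D.
  rewrite [2 *:r _](_ : _ = d (y + 1)); last by rewrite -[in RHS](scale1rr (y + 1)) /d -scalerrDl.
  by rewrite /C /D /Z /c /d starD starB sy; ncring.
(* In addition, the parallelogram law for [1 - y] and [y - z]: [W + P = 2 (1 - y)^2 + 2 D]. *)
have e2 : 12 *:r 1 - 3 *:r C - W =
    P + d (d (d (y - y * y))) + (d (d (1 - Z)) + d (1 - Z)) + d (d (1 - y)) + D :> A.
  have -> : 12 *:r 1 = d (d (1 + 1 + 1)) :> A.
    by rewrite -[in RHS](scale1rr 1) /d -!scalerrDl; congr (_%:C%C *: _); ring.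
  have -> : 3 *:r C = C + C + C.
    by rewrite -[in RHS](scale1rr C) /d -!scalerrDl; congr (_%:C%C *: _); ring.
  by rewrite /C /D /Z /P /c /d /W !(starD, starB, starN) star1 sy; ncring.
have : pos ((12 + k) *:r 1 - (k / 2 + 3) *:r C).
  have -> : (12 + k) *:r 1 - (k / 2 + 3) *:r C =
      (12 *:r 1 - 3 *:r C - W) + (k / 2) *:r (2 *:r (y + 1) - C) :> A.
    rewrite Wy scalerBr scalerrA divfK// scalerDr !scalerrDl; ncring.
  rewrite e1 e2; apply: posD.
    apply: (posD _ pD); apply: posD; last by do 2 apply: (pd).
    apply: posD; first by apply: (posD pP); do 3 apply: (pd).
    by apply: posD; [apply: (pd); apply: (pd)|apply: (pd)].
  by apply: posZ; [lra|apply: (posD _ pD); apply: posD; exact: pd].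
move=> pC; have : nm ((k / 2 + 3) *:r C) <= 12 + k.
  apply: pos_nm_le pC; first by rewrite addr_gt0.
  by apply: posZ; [lra|exact: pos_starM].
rewrite nmZ ger0_norm; last by lra.
rewrite nm_starM nc; lra.
Qed.

Lemma nm_isometry_mul u x : star u * u = 1 -> nm (u * x) = nm x.
Proof.
move=> uu; apply/eqP; rewrite -(@eqrXn2 _ 2)// ?nm_ge0// -!nm_starM starM.
by rewrite mulrA -(mulrA (star x)) uu mulr1.
Qed.

Lemma exposed_mul_unitary u x : unitaries A u -> exposed x -> exposed (u * x).
Proof.
move=> [uu uu'].
apply: (@exposed_linear_isometry _ _ ( *%R u) ( *%R (star u))).
- exact: mulrDr.
- exact: mulrDr.
- by move=> y; rewrite /= !nmE nm_isometry_mul.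
- by move=> y; rewrite /= !nmE nm_isometry_mul ?starK.
- by move=> y; rewrite mulrA uu mul1r.
- by move=> y; rewrite mulrA uu' mul1r.
Qed.

Lemma exposed_star x : exposed x -> exposed (star x).
Proof.
apply: (@exposed_linear_isometry _ _ (@star R A) (@star R A)); try exact: starD.
- by move=> y; rewrite /= !nmE nm_star.
- by move=> y; rewrite /= !nmE nm_star.
- exact: starK.
- exact: starK.
Qed.

Lemma exposed_unitary u : unitaries A u -> exposed u.
Proof. by move=> uu; rewrite -[u]mulr1; exact: exposed_mul_unitary exposed1. Qed.

Lemma exposed_nm x : exposed x -> nm x = 1.
Proof. by case=> /unit_sphereE. Qed.

Lemma nm_mulx_star x : nm (x * star x) = nm x ^+ 2.
Proof. by rewrite -{1}[x]starK nm_starM nm_star. Qed.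

Lemma sa_starM x : star (star x * x) = star x * x.
Proof. by rewrite starM starK. Qed.

Lemma sa_mulx_star x : star (x * star x) = x * star x.
Proof. by rewrite starM starK. Qed.

(** With [r] and [r'] the roots of [1 - x^* x] and [1 - x x^*], both [x + r' c r] and [x - r' c r]
    stay in the unit ball for small [c]; extremality of [x] gives [r' c r = 0]. *)
Lemma exposed_sqrt1B_orth x b : exposed x ->
  sqrt1B (x * star x) * b * sqrt1B (star x * x) = 0.
Proof.
move=> ex; have nx := exposed_nm ex.
have n1 : nm (star x * x) <= 1 by rewrite nm_starM nx expr1n.
have n2 : nm (x * star x) <= 1 by rewrite nm_mulx_star nx expr1n.
have sr := star_sqrt1B n1 (sa_starM x).
have sr' := star_sqrt1B n2 (sa_mulx_star x).
have xr : x * sqrt1B (star x * x) = sqrt1B (x * star x) * x.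
  by apply: sqrt1B_intertwine => //; rewrite mulrA.
have rx : sqrt1B (star x * x) * star x = star x * sqrt1B (x * star x).
  by have := congr1 (@star _ _) xr; rewrite !starM sr sr'.
have rr := sqrt1B_sqr n1; have rr' := sqrt1B_sqr n2.
move: (sqrt1B (star x * x)) (sqrt1B (x * star x)) sr sr' xr rx rr rr' => r r' sr sr' xr rx rr rr'.
have nr' : nm (r' * r') <= 2.
  by rewrite rr'; have := nmB 1 (x * star x); rewrite nm1; lra.
(* Since [x^* r' = r x^*], one has [1 - (x + a)^* (x + a) = r (1 - g) r]; the bound 1/4 on [c]
   ensures [nm g <= 1]. *)
have small c : nm c <= 4^-1 -> nm (x + r' * c * r) <= 1.
  move=> c4; set a := r' * c * r.
  pose g := star x * c + star c * x + star c * (r' * r') * c.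
  have sg : star g = g.
    by rewrite /g !starD !starM !starK sr' [star c * x + _]addrC !mulrA.
  have ng : nm g <= 1.
    have := nmD (star x * c + star c * x) (star c * (r' * r') * c).
    have := nmD (star x * c) (star c * x).
    have := nmM (star x) c; have := nmM (star c) x.
    have := nmM (star c * (r' * r')) c; have := nmM (star c) (r' * r').
    rewrite !nm_star nx -/g; have := nm_ge0 c; have := nm_ge0 (r' * r').
    have : nm (star c * (r' * r')) * nm c <= nm c * nm (r' * r') * nm c.
      by rewrite ler_wpM2r ?nm_ge0// -(nm_star c) nmM.
    have : nm c * nm (r' * r') * nm c <= 4^-1 * 2 * 4^-1.
      by rewrite !ler_pM ?mulr_ge0 ?nm_ge0.
    lra.
  have hx : 1 *:r 1 - star (x + a) * (x + a) = star (sqrt1B g * r) * (sqrt1B g * r) :> A.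
    rewrite starM star_sqrt1B// sr mulrA -(mulrA r) sqrt1B_sqr//.
    have -> : r * (1 - g) * r = r * r - r * g * r by ncring.
    rewrite rr /g !mulrDr !mulrDl !mulrA rx -(mulrA _ x r) xr.
    rewrite starD /a !starM sr sr' scale1rr; ncring.
  have := @pos_nm_le _ _ (star (x + a) * (x + a)) 1 ltr01 (pos_starM _).
  rewrite hx nm_starM => /(_ (pos_starM _)).
  by rewrite expr_le1// nm_ge0.
have small0 c : nm c <= 4^-1 -> r' * c * r = 0.
  move=> c4; apply: (exposed_extreme ex).
    by rewrite nmE -[1]/((1%:C)%C : R[i]) lecR small.
  rewrite nmE -[1]/((1%:C)%C : R[i]) lecR.
  have -> : x - r' * c * r = x + r' * (- c) * r by rewrite mulrN mulNr.
  by rewrite small// nmN.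
have t0 : 0 < 4 * (nm b + 1) by have := nm_ge0 b; lra.
apply: (@scalerr_inj _ _ (4 * (nm b + 1))^-1); first by rewrite invr_eq0 gt_eqF.
rewrite scalerAl scalerAr; apply: small0.
rewrite nmZ gtr0_norm ?invr_gt0// ler_pdivrMl//; lra.
Qed.

Lemma exposed_orth x b : exposed x -> (1 - x * star x) * b * (1 - star x * x) = 0.
Proof.
move=> ex; have nx := exposed_nm ex.
rewrite -!sqrt1B_sqr ?nm_starM ?nm_mulx_star ?nx ?expr1n//.
rewrite -(mulrA _ _ b) -mulrA (mulrA (_ * b)) exposed_sqrt1B_orth//.
by rewrite mul0r mulr0.
Qed.

(** The relation above at [b = x], where [r' x r = x r^2 = x (1 - x^* x)]. *)
Lemma exposed_partial_isometry x : exposed x -> x * star x * x = x.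
Proof.
move=> ex; have nx := exposed_nm ex.
have n1 : nm (star x * x) <= 1 by rewrite nm_starM nx expr1n.
have n2 : nm (x * star x) <= 1 by rewrite nm_mulx_star nx expr1n.
have := exposed_sqrt1B_orth x ex.
rewrite -(sqrt1B_intertwine n1 n2); last by rewrite mulrA.
by rewrite -mulrA sqrt1B_sqr// mulrBr mulr1 mulrA => /subr0_eq.
Qed.

End Exposed.

(** * Isolated points between a point and its antipode *)

(** Squared because [K] need not contain the square root of 2. *)
Definition antipodal_mid (K : numFieldType) (V : normedModType K) (v x : V) :=
  [/\ exposed x, `|v + x| ^+ 2 <= 2 & `|v - x| ^+ 2 <= 2].

Definition isolated_mid (K : numFieldType) (V : normedModType K) (v x : V) :=
  antipodal_mid v x /\
  exists2 e : K, 0 < e &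
    forall y, antipodal_mid v y -> `|y - x| < e -> y = x.

Lemma spherical_isometry_isolated_mid (K : numFieldType) (V W : normedModType K)
    (T : V -> W) (S : W -> V) :
  spherical_isometry T -> spherical_isometry S ->
  (forall x, unit_sphere V x -> S (T x) = x) ->
  (forall y, unit_sphere W y -> T (S y) = y) ->
  forall v x, exposed v -> isolated_mid v x -> isolated_mid (T v) (T x).
Proof.
move=> Ti Si SK TK.
(* Stated for arbitrary spaces since it is applied to both [T] and [S]. The bound on [v + x] is a
   distance to [- x], and [T (- x) = - T x] as [x] is exposed. *)
have mid (V' W' : normedModType K) (T' : V' -> W') (S' : W' -> V') :
    spherical_isometry T' -> spherical_isometry S' ->
    (forall x, unit_sphere V' x -> S' (T' x) = x) ->
    (forall y, unit_sphere W' y -> T' (S' y) = y) ->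
    forall v x, exposed v -> antipodal_mid v x -> antipodal_mid (T' v) (T' x).
  move=> Ti' Si' SK' TK' v x [Sv _] [ex h1 h2].
  have [eTx TN] := spherical_isometry_exposed Ti' Si' SK' TK' ex.
  have Sx := ex.1; split=> //; last by rewrite Ti'.2.
  by rewrite -[T' x]opprK -TN Ti'.2 ?opprK//; exact: unit_sphereN.
move=> v x ev [mvx [e e0 he]]; split; first exact: (mid _ _ _ _ Ti Si SK TK).
exists e => // y my yx.
have [eTv _] := spherical_isometry_exposed Ti Si SK TK ev.
have Sy : unit_sphere W y by case: my => [[]].
have Sx : unit_sphere V x by case: mvx => [[]].
rewrite -(TK _ Sy); congr T; apply: he.
  by rewrite -(SK v ev.1); exact: (mid _ _ _ _ Si Ti TK SK).
by rewrite -(SK x Sx) Si.2//; exact: Ti.1.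
Qed.

(** * Unitaries as the exposed points with an isolated mid *)

Section Unitaries.
Variables (R : realType) (A : cstarAlgType R).
Implicit Types (b c e g k p q u v w x y z : A) (s t : R).

Lemma sqr_norm_le2 x : (`|x| ^+ 2 <= 2) = (nm x ^+ 2 <= 2).
Proof. by rewrite nmE -rmorphXn -(rmorph_nat (real_complex R)) lecR. Qed.

Lemma antipodal_midP v x : antipodal_mid v x <->
  [/\ exposed x, nm (v + x) ^+ 2 <= 2 & nm (v - x) ^+ 2 <= 2].
Proof. by rewrite /antipodal_mid !sqr_norm_le2. Qed.

Lemma isolated_mid_star v x : isolated_mid v x -> isolated_mid (star v) (star x).
Proof.
have mid v' x' : antipodal_mid v' x' -> antipodal_mid (star v') (star x').
  move=> /antipodal_midP[ex h1 h2]; apply/antipodal_midP; split.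
  - exact: exposed_star.
  - by rewrite -starD nm_star.
  - by rewrite -starB nm_star.
move=> [/mid m [e e0 he]]; split=> //; exists e => // y my yx.
rewrite -[y]starK; congr star; apply: he; first by rewrite -[v]starK; exact: mid.
by rewrite nmE -nm_star starB starK -nmE.
Qed.

Lemma eq_i_of_near w : exposed w -> nm (1 + w) ^+ 2 <= 2 ->
  nm (1 - w) ^+ 2 <= 2 -> nm (w - 'i%C *: 1) < 1 -> w = 'i%C *: 1.
Proof.
move=> ew h1 h2 near1.
have www := exposed_partial_isometry ew.
have contr c : nm c <= nm (w - 'i%C *: 1) * nm c -> c = 0.
  move=> hc; apply: nm_eq0; apply/eqP; rewrite eq_le nm_ge0 andbT leNgt.
  by apply/negP => c0; move: hc; rewrite -subr_ge0 -{2}[nm c]mul1r -mulrBl pmulr_lge0//; lra.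
(* The defect [c = 1 - w^* w] satisfies [w c = 0], so [nm c = nm ((w - i) c)], and [contr] gives
   [c = 0]. *)
have ww : star w * w = 1.
  apply/esym/eqP; rewrite -subr_eq0; apply/eqP/contr.
  rewrite (le_trans _ (nmM _ _))//.
  have wc0 : w * (1 - star w * w) = 0 by rewrite mulrBr mulr1 mulrA www subrr.
  by rewrite [in leRHS]mulrBl wc0 sub0r nmN -scalerAl mul1r nmZi.
have ww' : w * star w = 1.
  apply/esym/eqP; rewrite -subr_eq0; apply/eqP/contr.
  have wc0 : (1 - w * star w) * w = 0 by rewrite mulrBl mul1r www subrr.
  rewrite mulrC (le_trans _ (nmM _ _))//.
  by rewrite [in leRHS]mulrBr wc0 sub0r nmN -scalerAr mulr1 nmZi.
have sww : star (w + star w) = w + star w by rewrite starD starK addrC.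
(* The bound on [1 + c] says [2 + c + c^* <= 2]; used for [w] and [- w], it makes [w]
   skew-adjoint. *)
have p2 c : star c * c = 1 -> nm (1 + c) ^+ 2 <= 2 -> pos (- (c + star c)).
  rewrite -nm_starM => cc /nm_le_pos; rewrite sa_starM => /(_ erefl).
  suff -> : 2 *:r 1 - star (1 + c) * (1 + c) = - (c + star c) by [].
  have -> : 2 *:r 1 = 1 + 1 :> A by rewrite -[in RHS](scale1rr 1) -scalerrDl.
  have -> : star (1 + c) * (1 + c) = 1 + c + star c + star c * c by rewrite starD star1; ncring.
  by rewrite cc; ncring.
have h0 : w + star w = 0.
  apply: pos_anti; last exact: p2.
  have -> : w + star w = - (- w + star (- w)) by rewrite starN; ncring.
  by apply: p2 => //; rewrite starN mulrNN.
have sw : star w = - w by apply/eqP; rewrite -addr_eq0 addrC h0.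
(* As [w^2 = -1], [d^2 = - 2 i d]; so [2 nm d <= (nm d)^2] with [nm d < 1]. *)
pose d := w - 'i%C *: 1.
have dd : d * d = - ('i%C *: d + 'i%C *: d).
  have wd : w = d + 'i%C *: 1 by rewrite /d subrK.
  have h : w * w = - 1 by rewrite -ww sw mulNr opprK.
  clearbody d; rewrite wd in h; move: h.
  rewrite mulrDl !mulrDr scaleiMM -!scalerAr -!scalerAl !mulr1 !mul1r => h.
  have -> : d * d = d * d + 'i%C *: d + ('i%C *: d - 1) - ('i%C *: d + 'i%C *: d) + 1 by ncring.
  rewrite h; ncring.
apply/eqP; rewrite -subr_eq0 -/d; apply/eqP/contr; rewrite -/d.
have := nmM d d; rewrite dd nmN -[X in nm (X + X)](scale1rr) -scalerrDl nmZ nmZi.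
rewrite ger0_norm//; have := nm_ge0 d; lra.
Qed.

Lemma isolated_mid_unitary u : unitaries A u -> isolated_mid u ('i%C *: u).
Proof.
move=> uu; have su : unitaries A (star u) by rewrite /unitaries /= starK; case: uu.
have [u1 u2] := uu.
have ii : unitaries A ('i%C *: u).
  by split; rewrite starZi ?(mulNr, mulrN) scaleiMM opprK.
have n1 (l : R[i]) : `|l *: u| = `|l| by rewrite normrZ (exposed_unitary uu).1 mulr1.
split; first split.
- exact: exposed_unitary.
- rewrite -[u in u + _]scale1r -scalerDl n1 -add_Re2_Im2 /= addr0 add0r expr1n.
  by rewrite -(rmorph_nat (real_complex R)) lecR.
- rewrite -[u in u - _]scale1r -scalerBl n1 -add_Re2_Im2 /= subr0 sub0r sqrrN expr1n.
  by rewrite -(rmorph_nat (real_complex R)) lecR.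
exists 1 => // x /antipodal_midP[ex h1 h2].
rewrite nmE -[X in _ < X](rmorph1 (real_complex R)) ltcR => xu.
have mul c : nm (star u * c) = nm c by apply: nm_isometry_mul; rewrite starK.
have w : star u * x = 'i%C *: 1.
  apply: eq_i_of_near; first exact: exposed_mul_unitary.
  - by rewrite -u1 -mulrDr mul.
  - by rewrite -u1 -mulrBr mul.
  - by rewrite -u1 scalerAr -mulrBr mul.
by rewrite -[x]mul1r -u2 -mulrA w -scalerAr mulr1.
Qed.

(* A unitary for [k] skew-adjoint of norm at most 1, close to 1 for small [k]. *)
Definition skew_unitary k : A := k + sqrt1B (star k * k).

Lemma nm_starM_le1 k : nm k <= 1 -> nm (star k * k) <= 1.
Proof. by move=> k1; rewrite nm_starM expr_le1// nm_ge0. Qed.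

Lemma skew_unitaryP k : star k = - k -> nm k <= 1 -> unitaries A (skew_unitary k).
Proof.
move=> sk /nm_starM_le1 k1; rewrite /skew_unitary.
have ks : k * sqrt1B (star k * k) = sqrt1B (star k * k) * k.
  by apply: sqrt1B_intertwine => //; rewrite sk !(mulNr, mulrN) mulrA.
have ss := sqrt1B_sqr k1; have st := star_sqrt1B k1 (sa_starM k).
move: (sqrt1B _) ks ss st => s ks ss st.
rewrite /unitaries /= starD sk st; split.
  have -> : (- k + s) * (k + s) = s * s + (- k) * k + s * k - k * s by ncring.
  by rewrite ss ks -{1}sk addrK subrK.
have -> : (k + s) * (- k + s) = s * s + (- k) * k - s * k + k * s by ncring.
by rewrite ss ks -{1}sk subrK subrK.
Qed.

(** Multiplication by a unitary keeps [x] exposed, and for small [t] it moves [x] by less than the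
    isolation radius. *)
Lemma isolated_mid_fixed v x k : isolated_mid v x -> star k = - k ->
  (forall t, 0 < t -> nm (t *:r k) <= 1 ->
    let w := skew_unitary (t *:r k) * x in
    nm (v + w) ^+ 2 <= 2 /\ nm (v - w) ^+ 2 <= 2) ->
  exists t, [/\ 0 < t, nm (t *:r k) <= 1 & skew_unitary (t *:r k) * x = x].
Proof.
move=> [[ex _ _] [e' e'0 he]] sk hk.
have ee : e' = ((complex.Re e')%:C)%C by rewrite RRe_real// gtr0_real.
set e := complex.Re e' in ee.
have e0 : 0 < e by move: e'0; rewrite ee ltcR.
(* This gives [nm (t k) <= m / 3], so the unitary is within [m / 3 + (m / 3)^2 < e] of 1. *)
pose m := Num.min e 1; pose t := m / (3 * (nm k + 1)).
have m0 : 0 < m by rewrite lt_min e0 ltr01.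
have k0 := nm_ge0 k.
have t0 : 0 < t by rewrite divr_gt0//; lra.
have tk : nm (t *:r k) <= m / 3.
  have : t * (3 * (nm k + 1)) = m by rewrite divfK// gt_eqF//; lra.
  by rewrite nmZ gtr0_norm//; lra.
have m1 : m <= 1 by rewrite ge_min lexx orbT.
have me : m <= e by rewrite ge_min lexx.
have tk1 : nm (t *:r k) <= 1 by lra.
exists t; split=> //; apply: he.
  have [h1 h2] := hk t t0 tk1; apply/antipodal_midP; split=> //.
  by apply: exposed_mul_unitary => //; apply: skew_unitaryP => //; rewrite starZr sk scalerN.
rewrite ee nmE ltcR -{2}[x]mul1r -mulrBl.
apply: le_lt_trans (nmM _ _) _; rewrite (exposed_nm ex) mulr1.
have -> : skew_unitary (t *:r k) - 1 = t *:r k - sqrtb (star (t *:r k) * (t *:r k)).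
  by rewrite /skew_unitary /sqrt1B; ncring.
apply: le_lt_trans (nmB _ _) _.
have := nm_sqrtb (nm_starM_le1 tk1); rewrite nm_starM.
have := nm_ge0 (t *:r k); nra.
Qed.

(** For the projection [r = 1 - v v^*] the unitaries built from [i r] fix [v], hence preserve the
    distances of [x] to [v] and [- v]; so one of them fixes [x]. *)
Lemma isolated_mid_range v x : exposed v -> isolated_mid v x ->
  (1 - v * star v) * x = 0.
Proof.
move=> ev iso; have vvv := exposed_partial_isometry ev.
pose r := 1 - v * star v; pose k := 'i%C *: r.
have sr : star r = r by rewrite /r starB star1 starM starK.
have rr : r * r = r.
  have -> : r * r = r - (v - v * star v * v) * star v by rewrite /r; ncring.
  by rewrite vvv subrr mul0r subr0.
have rv : r * v = 0 by rewrite /r mulrBl mul1r vvv subrr.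
have sk : star k = - k by rewrite starZi sr.
have skt t : star (t *:r k) = - (t *:r k) by rewrite starZr sk scalerN.
have [|t [t0 tk1 hU]] := isolated_mid_fixed iso sk.
  move=> t t0 tk1; have [UU _] := skew_unitaryP (skt t) tk1.
  have Uv : skew_unitary (t *:r k) * v = v.
    have kv : (t *:r k) * v = 0 by rewrite -!scalerAl rv !scaler0.
    rewrite /skew_unitary mulrDl kv add0r -(@sqrt1B_intertwine _ _ 0).
    - by rewrite sqrt1B0 mulr1.
    - by rewrite nm0.
    - exact: nm_starM_le1.
    - by rewrite mulr0 -mulrA kv mulr0.
  move=> w; have [[_ h1 h2] _] := iso; move: h1 h2; rewrite !sqr_norm_le2.
  by rewrite -{3 4}Uv -mulrDr -mulrBr !nm_isometry_mul.
have st := star_sqrt1B (nm_starM_le1 tk1) (sa_starM _).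
(* [x^* U x = x^* x] is self-adjoint, so its skew part [t i x^* r x] vanishes. *)
have := congr1 ( *%R (star x)) hU.
rewrite /skew_unitary mulrDl mulrDr; set a := star x * (t *:r k * x) => h1.
have := congr1 (@star _ _) h1; rewrite starD.
have -> : star a = - a by rewrite /a !starM starK skt mulrN mulNr !mulrA.
rewrite !starM st starK -mulrA => h2.
have /addxx_eq0 : a + a = 0.
  set b := star x * (_ * x) in h1 h2.
  have -> : a + a = (a + b) - (- a + b) by ncring.
  by rewrite h1 h2 subrr.
rewrite /a -!scalerAl -!scalerAr => h3.
have /scalerr_inj h4 := h3.
apply: star_sqr_eq0; rewrite starM sr.
have -> : star x * r * (r * x) = star x * (r * r * x) by rewrite !mulrA.
rewrite rr.
have := h4 (lt0r_neq0 t0); move=> /(congr1 ( *:%R 'i%C)).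
by rewrite scalerA -expr2 sqr_i scaleN1r scaler0 => /eqP; rewrite oppr_eq0 => /eqP.
Qed.

(** With [r = 1 - v v^*] and [e = x^* x], the aim is [r e = 0]: as [r x = 0], [exposed_orth] for [x]
    then gives [r = 0]. To this end [e] is split along [y = v^* x], which is skew-adjoint with
    [y^2 = - e]. *)
Lemma isolated_mid_coisometry v x : exposed v -> isolated_mid v x ->
  v * star v = 1.
Proof.
move=> ev iso; have vvv := exposed_partial_isometry ev.
have [[ex h1 h2] _] := iso; move: h1 h2; rewrite !sqr_norm_le2 => h1 h2.
have rx := isolated_mid_range ev iso.
have := isolated_mid_range (exposed_star ev) (isolated_mid_star iso).
rewrite starK => px; have {px} xp : x * (star v * v) = x.
  have := congr1 (@star _ _) px.
  by rewrite starM starK star0 starB star1 sa_starM mulrBr mulr1 => /subr0_eq.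
pose q := v * star v; pose p := star v * v; pose e := star x * x; pose y := star v * x.
have qx : q * x = x by move: rx; rewrite mulrBl mul1r => /subr0_eq.
pose r := 1 - q.
have sr : star r = r by rewrite /r starB star1 sa_mulx_star.
have rr : r * r = r.
  have -> : r * r = r - (v - v * star v * v) * star v by rewrite /r /q; ncring.
  by rewrite vvv subrr mul0r subr0.
have vr : star v * r = 0.
  have := congr1 (@star _ _) vvv; rewrite !starM starK => h.
  by rewrite /r /q mulrBr mulr1 h subrr.
have xr : star x * r = 0 by rewrite -sr -starM -/r rx star0.
have se : star e = e by exact: sa_starM.
have sp : star p = p by exact: sa_starM.
have xe : x * e = x by rewrite /e mulrA exposed_partial_isometry.
have ep : e * p = e by rewrite /e -mulrA xp.
have ee : e * e = e by rewrite {1}/e -mulrA xe.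
have ye : y * e = y by rewrite /y -mulrA xe.
have sy : star y = - y.
  (* The bounds on [v + x] and [v - x] say [2 - p - e - h >= 0] and [2 - p - e + h >= 0]. Compressed
     by [e <= p] these become [- e h e] and [e h e], so both vanish. Then [M e = 0], that is
     [y + y^* e = 0]. *)
  pose h := y + star y.
  have sh : star h = h by rewrite /h starD starK addrC.
  pose M : A := 1 + 1 - p - e - h.
  have two : 2 *:r 1 = 1 + 1 :> A by rewrite -[in RHS](scale1rr 1) -scalerrDl.
  have pM : pos M.
    rewrite -nm_starM in h1; have := nm_le_pos (sa_starM _) h1; rewrite two.
    suff -> : 1 + 1 - star (v + x) * (v + x) = M by [].
    by rewrite starD /M /p /e /h /y starM starK; ncring.
  have pM' : pos (1 + 1 - p - e + h).
    rewrite -nm_starM in h2; have := nm_le_pos (sa_starM _) h2; rewrite two.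
    suff -> : 1 + 1 - star (v - x) * (v - x) = 1 + 1 - p - e + h by [].
    by rewrite starB /p /e /h /y starM starK; ncring.
  have eMe : e * M * e = - (e * h * e).
    have -> : e * M * e = e * e + e * e - e * p * e - e * e * e - e * h * e by rewrite /M; ncring.
    by rewrite ep !ee addrK subrr sub0r.
  have pe := pos_conj e pM; rewrite se eMe in pe.
  have pe' : pos (e * h * e).
    have := pos_conj e pM'; rewrite se.
    have -> : e * (1 + 1 - p - e + h) * e =
        e * e + e * e - e * p * e - e * e * e + e * h * e by ncring.
    by rewrite ep !ee addrK subrr add0r.
  have ehe := pos_anti pe' pe.
  have [m [sm mm _ _]] := pos_sqrt pM.
  have me : m * e = 0.
    apply: star_sqr_eq0; rewrite starM sm se mulrA -(mulrA e) mm eMe ehe.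
    by rewrite oppr0.
  have Me : M * e = 0 by rewrite -mm -mulrA me mulr0.
  have pe1 : p * e = e by have := congr1 (@star _ _) ep; rewrite starM se sp.
  have he : y + star y * e = 0.
    have -> : y + star y * e = e + e - p * e - e * e - M * e.
      by rewrite -{1}ye /M /h; ncring.
    by rewrite Me pe1 ee addrK subrr subr0.
  have sye : star y * e = - y by apply/eqP; rewrite -addr_eq0 addrC he.
  have ey : e * y = - star y.
    by have := congr1 (@star _ _) sye; rewrite starM starK se starN.
  by rewrite -[star y]opprK -ey -[in e * y]ye mulrA ey mulNr sye opprK.
have yy : y * y = - e.
  by rewrite -[LHS]opprK -mulNr -sy {1}/y starM starK mulrA -(mulrA _ v) -/q -mulrA qx.
have ey : e * y = y.
  by have := congr1 (@star _ _) ye; rewrite starM se sy mulrN => /oppr_inj.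
have key b g (l : R[i]) : star g = g -> g * e = g -> y * g = l *: g ->
    g * y = l *: g -> r * b * g = 0.
  move=> sg ge yg gy; pose z := r * b * g.
  have sz : star z = g * star b * r by rewrite /z !starM sr sg mulrA.
  have rz : r * z = z by rewrite /z !mulrA rr.
  have zx : star z * x = 0 by rewrite sz -mulrA rx mulr0.
  have xz : star x * z = 0 by rewrite -rz mulrA xr mul0r.
  have vz : star v * z = 0 by rewrite -rz mulrA vr mul0r.
  have yzz : y * (star z * z) = star z * z * y.
    have -> : star z * z = g * (star b * r * (r * b)) * g by rewrite sz /z !mulrA.
    by rewrite -(mulrA _ g y) gy 2!(mulrA y) yg -!scalerAl -scalerAr.
  (* [k] rotates [x] towards [z], whose range is orthogonal to that of [v];
     since [star z * z] commutes with [star v * x], so does the cosine part. *)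
  pose k := z * star x - x * star z.
  have sk : star k = - k by rewrite /k starB !starM !starK opprB.
  have kx : k * x = z.
    have -> : k * x = z * e - x * (star z * x) by rewrite /k /e; ncring.
    by rewrite zx mulr0 subr0 /z -mulrA ge.
  have kz : k * z = - (x * (star z * z)).
    have -> : k * z = z * (star x * z) - x * (star z * z) by rewrite /k; ncring.
    by rewrite xz mulr0 sub0r.
  have Ux t : nm (t *:r k) <= 1 -> exists a : A, [/\ star a = a, y * a = a * y &
      skew_unitary (t *:r k) * x = t *:r z + x * a].
    move=> tk1; pose z' := t *:r z.
    have nz' : nm z' <= 1.
      rewrite /z' -kx scalerAl (le_trans (nmM _ _))//.
      by rewrite (exposed_nm ex) mulr1.
    have nzz := nm_starM_le1 nz'; have nkk := nm_starM_le1 tk1.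
    exists (sqrt1B (star z' * z')); split.
    - by apply: star_sqrt1B => //; exact: sa_starM.
    - apply: sqrt1B_intertwine => //.
      by rewrite starZr scalerrMM -scalerAr -scalerAl yzz.
    - rewrite /skew_unitary mulrDl -scalerAl kx; congr (_ + _).
      symmetry; apply: sqrt1B_intertwine => //.
      rewrite !starZr sk scalerN mulNr !scalerrMM -scalerAr mulNr -scalerAl -mulrA.
      by rewrite kx kz scalerN opprK.
  have [|t [t0 tk1]] := isolated_mid_fixed iso sk.
    (* As [v^* w = y a] is skew-adjoint, the cross terms cancel: both squared moduli equal [p + e],
       of norm at most 2. *)
    move=> t t0 tk1 w; have [a [sa ya wE]] := Ux t tk1.
    have ww : star w * w = e.
      have skt : star (t *:r k) = - (t *:r k) by rewrite starZr sk scalerN.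
      have [UU _] := skew_unitaryP skt tk1.
      by rewrite /w starM mulrA -(mulrA (star x)) UU mulr1.
    have vw : star v * w = y * a.
      by rewrite /w wE mulrDr -scalerAr vz scaler0 add0r mulrA.
    have wv : star w * v = - (y * a).
      have <- : star (y * a) = - (y * a) by rewrite starM sa sy mulrN ya.
      by rewrite -vw starM starK.
    have np : nm p + nm e <= 2.
      by rewrite /p /e !nm_starM (exposed_nm ev) (exposed_nm ex) expr1n.
    rewrite -!nm_starM starD starB !mulrDl !mulrDr !mulNr !mulrN ww vw wv !opprK.
    have -> : star v * v + y * a + (- (y * a) + e) = p + e by rewrite /p; ncring.
    have -> : star v * v - y * a + (y * a + e) = p + e by rewrite /p; ncring.
    by split; exact: le_trans (nmD _ _) np.
  have [a [_ _ ->]] := Ux t tk1.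
  move=> /(congr1 ( *%R r)); rewrite mulrDr -scalerAr rz mulrA rx mul0r addr0.
  exact/scalerr_inj/lt0r_neq0.
have iyy : 'i%C *: (y * y) = - ('i%C *: e) by rewrite yy scalerN.
have siy : star ('i%C *: y) = 'i%C *: y by rewrite starZi sy scalerN opprK.
have iiy : 'i%C *: ('i%C *: y) = - y by rewrite scalerA -expr2 sqr_i scaleN1r.
(* Spectral projections of the skew-adjoint [y], up to a factor 2. *)
have k1 b : r * b * (e - 'i%C *: y) = 0.
  apply: (key _ _ 'i%C).
  - by rewrite starB se siy.
  - by rewrite mulrBl ee -scalerAl ye.
  - by rewrite mulrBr ye -scalerAr iyy scalerBr iiy !opprK addrC.
  - by rewrite mulrBl ey -scalerAl iyy scalerBr iiy !opprK addrC.
have k2 b : r * b * (e + 'i%C *: y) = 0.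
  apply: (key _ _ (- 'i%C)).
  - by rewrite starD se siy.
  - by rewrite mulrDl ee -scalerAl ye.
  - by rewrite mulrDr ye -scalerAr iyy scaleNr scalerDr iiy opprD opprK addrC.
  - by rewrite mulrDl ey -scalerAl iyy scaleNr scalerDr iiy opprD opprK addrC.
have re : r * e = 0.
  apply: addxx_eq0.
  have := congr2 +%R (k1 1) (k2 1); rewrite addr0 mulr1 -mulrDr.
  by rewrite addrACA addNr addr0 mulrDr.
have orth := exposed_orth 1 ex; rewrite mulr1 -/e in orth.
have : r * ((1 - x * star x) * (1 - e)) = 0 by rewrite orth mulr0.
have -> : r * ((1 - x * star x) * (1 - e)) = (r - r * x * star x) * (1 - e) by ncring.
rewrite rx mul0r subr0 mulrBr mulr1 re subr0 /r.
by move=> /subr0_eq.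
Qed.

Lemma unitary_iff_isolated_mid u :
  unitaries A u <-> exposed u /\ exists x, isolated_mid u x.
Proof.
split=> [uu|[eu [x iux]]].
  by split; [exact: exposed_unitary|exists ('i%C *: u); exact: isolated_mid_unitary].
split; last exact: isolated_mid_coisometry iux.
(* The other unitary equation is the coisometry equation of [star u]. *)
rewrite -{2}[u]starK.
exact: isolated_mid_coisometry (exposed_star eu) (isolated_mid_star iux).
Qed.

End Unitaries.

(** * Transport of unitaries in both directions *)

Lemma spherical_isometry_unitaries (R : realType) (A B : cstarAlgType R)
    (T : A -> B) (S : B -> A) :
  spherical_isometry T -> spherical_isometry S ->
  (forall x, unit_sphere A x -> S (T x) = x) ->
  (forall y, unit_sphere B y -> T (S y) = y) ->
  forall u, unitaries A u -> unitaries B (T u).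
Proof.
move=> Ti Si SK TK u /unitary_iff_isolated_mid[eu [x ix]].
apply/unitary_iff_isolated_mid; split.
  by have [] := spherical_isometry_exposed Ti Si SK TK eu.
exists (T x); exact: (spherical_isometry_isolated_mid Ti Si SK TK).
Qed.

Theorem theorem3p2 (R : realType) (A B : cstarAlgType R) (T : A -> B)
    (T_maps : set_fun (unit_sphere A) (unit_sphere B) T)
    (T_surj : set_surj (unit_sphere A) (unit_sphere B) T)
    (T_isom : forall x y : A, unit_sphere A x -> unit_sphere A y ->
                `|T x - T y| = `|x - y|) :
  T @` unitaries A = unitaries B.
Proof.
(* The inverse of [T] on the sphere, with default 0 for points without a preimage there. *)
pose S y := xget 0 [set x | unit_sphere A x /\ T x = y].
have SP y : unit_sphere B y -> unit_sphere A (S y) /\ T (S y) = y.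
  by move=> /T_surj[x Sx Txy]; rewrite /S; case: xgetP => [_ -> //|/(_ x)[]].
have TK y : unit_sphere B y -> T (S y) = y by move=> /SP[].
have Ti : spherical_isometry T by [].
have Si : spherical_isometry S.
  split=> [y /SP[]//|x y Sx Sy].
  by rewrite -T_isom ?TK//; [case: (SP _ Sx)|case: (SP _ Sy)].
have SK x : unit_sphere A x -> S (T x) = x.
  move=> Sx; apply/eqP; rewrite -subr_eq0 -normr_eq0 -T_isom//.
    by rewrite TK ?subrr ?normr0//; exact: T_maps.
  by case: (SP _ (T_maps _ Sx)).
apply/seteqP; split=> [_ [u uu <-]|v uv].
  exact: (spherical_isometry_unitaries Ti Si).
exists (S v); first exact: (spherical_isometry_unitaries Si Ti).
exact/TK/unitaries_sub_sphere.
Qed.
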